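(* Let $N\ge 1$, $c\ge 1$, let $R(N)$ be the set of set-based judged runs of length $N$ over relevance degrees $\mathcal{a}_0\prec\cdots\prec\mathcal{a}_c$, and let $\preceq$ be the replacement [set-based] ordering on $R(N)$. Let $g$ be a gain function and let $RB>0$ be a constant. Then the generalized precision $gP$ and the generalized recall $gR$ are positive valuations on the lattice $(R(N),\wedge,\vee,\preceq)$. That is, for $M\in\{gP,gR\}$: $M(\hat r)+M(\hat s)=M(\hat r\vee\hat s)+M(\hat r\wedge\hat s)$ for all $\hat r,\hat s\in R(N)$, and $\hat r\preceq\hat s$, $\hat r\ne\hat s$ imply $M(\hat r)<M(\hat s)$.
   Context: Relevance degrees: $REL=\{\mathcal{a}_0,\ldots,\mathcal{a}_c\}$ is a finite totally ordered set (order $\preccurlyeq$) with $\mathcal{a}_0\prec\mathcal{a}_1\prec\cdots\prec\mathcal{a}_c$. A gain function is a strictly increasing map $g:REL\to[0,\infty)$ with $g(\mathcal{a}_0)=0$. Set-based judged runs: $R(N)$ is the set of all multisets $\hat r=\{\hat r_1,\ldots,\hat r_N\}$ of $N$ elements of $REL$ (repetitions allowed), with elements listed in decreasing order $\hat r_1\succcurlyeq\hat r_2\succcurlyeq\cdots\succcurlyeq\hat r_N$. Replacement [set-based] ordering: $\hat r\preceq\hat s$ if and only if $|\{i:\hat r_i\succcurlyeq\mathcal{a}_j\}|\le|\{i:\hat s_i\succcurlyeq\mathcal{a}_j\}|$ for all $j\in\{0,\ldots,c\}$. With this order $R(N)$ is a distributive lattice; $\wedge$ and $\vee$ denote its meet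 and join. Generalized precision: $gP(\hat r)=\frac1N\sum_{i=1}^N\frac{g(\hat r_i)}{g(\mathcal{a}_c)}$. Generalized recall: $gR(\hat r)=\frac1{RB}\sum_{i=1}^N\frac{g(\hat r_i)}{g(\mathcal{a}_c)}$, where $RB$ is a fixed positive constant (the recall base, i.e. the total number of relevant documents). *)

(* Defs.v *)
From HB Require Import structures.
From mathcomp Require Import all_boot all_order all_algebra.
From mathcomp Require Import finmap multiset reals.

Set Implicit Arguments.
Unset Strict Implicit.
Unset Printing Implicit Defensive.

Import Order.TTheory GRing.Theory Num.Theory.

(* A finite totally ordered set of relevance degrees a_0 < ... < a_c is a
   [REL : finTBOrderType d]; a_0 is [\bot] and a_c is [\top]. *)

Local Open Scope order_scope.

Record run d (REL : finTBOrderType d) (N : nat) := Run {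
  run_mset :> {mset REL}%mset;
  _ : size run_mset == N }.

HB.instance Definition _ d (REL : finTBOrderType d) N :=
  [isSub for @run_mset d REL N].
HB.instance Definition _ d (REL : finTBOrderType d) N :=
  [Choice of run REL N by <:].

Fact replacement_display : Order.disp_t. Proof. exact: Order.Disp tt tt. Qed.

Section Runs.
Context {d : Order.disp_t} {REL : finTBOrderType d} {N : nat}.
Implicit Types (r s t : run REL N) (a : REL) (i j : 'I_N).

Fact listing_subproof r : size (sort >=%O (run_mset r)) == N.
Proof. by rewrite size_sort; apply: valP r. Qed.

(* The elements of [r], with multiplicity, in decreasing order. *)
Definition listing r : N.-tuple REL := Tuple (listing_subproof r).

(* The informal indices 1, ..., N are shifted to 0, ..., N - 1. *)
Definition degree r i : REL := tnth (listing r) i.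

Definition count_ge r a : nat := #|[set i | a <= degree r i]|.

Definition replacement_le r s : bool :=
  [forall a, (count_ge r a <= count_ge s a)%N].

Lemma degree_decr r i j : (i <= j)%N -> degree r j <= degree r i.
Proof.
move=> ij; rewrite /degree !(tnth_nth \bot).
apply: (@sorted_leq_nth _ (>=%O : rel REL)) => //.
- by move=> y x z /= yx zy; apply: le_trans zy yx.
- exact: lexx.
- by apply: sort_sorted => x y; apply: le_total.
- by rewrite inE size_tuple.
- by rewrite inE size_tuple.
Qed.

Lemma degree_ext r s : degree r =1 degree s -> r = s.
Proof.
move=> E; apply: val_inj => /=.
have {}E : listing r = listing s by apply: eq_from_tnth.
have /(congr1 val) /= {}E := E.
have : perm_eq (run_mset r) (run_mset s).
  rewrite -(perm_sort >=%O) E perm_sort //.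
by move/eq_seq_msetP; rewrite !seq_mset_id.
Qed.

Lemma card_ord_lt k : (k <= N)%N -> #|[set j : 'I_N | (j < k)%N]| = k.
Proof.
move=> kN; rewrite -sum1_card.
under eq_bigl do rewrite inE.
by rewrite (big_ord_narrow kN) sum1_card card_ord.
Qed.

Lemma count_geP r a i : (a <= degree r i) = (i < count_ge r a)%N.
Proof.
apply/idP/idP => [ai|].
  rewrite -[i.+1](@card_ord_lt i.+1) //; apply: subset_leq_card.
  apply/subsetP => j; rewrite !inE ltnS => ji.
  exact: le_trans ai (degree_decr _ ji).
apply: contraTT => nai; rewrite -leqNgt.
rewrite -[X in (_ <= X)%N](@card_ord_lt i (ltnW (ltn_ord i))).
apply: subset_leq_card; apply/subsetP => j; rewrite !inE => aj.
rewrite ltnNge; apply: contra nai => ij.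
exact: le_trans aj (degree_decr _ ij).
Qed.

Lemma replacement_leP r s :
  reflect (forall i, degree r i <= degree s i) (replacement_le r s).
Proof.
apply: (iffP forallP) => [H i | H a].
  by rewrite count_geP (leq_trans _ (H _)) // -count_geP.
apply: subset_leq_card; apply/subsetP => i; rewrite !inE => ai.
exact: le_trans ai (H i).
Qed.

Fact mkrun_subproof (f : 'I_N -> REL) : size (seq_mset (codom f)) == N.
Proof. by rewrite (perm_size (perm_eq_seq_mset _)) size_codom card_ord. Qed.

Definition mkrun (f : 'I_N -> REL) : run REL N := Run (mkrun_subproof f).

(* [degree (mkrun f)] is [f] only when [f] is decreasing; otherwise the values
   of [f] get sorted. *)
Lemma degree_mkrun (f : 'I_N -> REL) :
  (forall i j, (i <= j)%N -> f j <= f i) -> degree (mkrun f) =1 f.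
Proof.
move=> fd.
have E : sort >=%O (seq_mset (codom f)) = codom f.
  have tr : transitive (>=%O : rel REL).
    by move=> y x z /= yx zy; apply: le_trans zy yx.
  apply: (sorted_eq tr).
  - by move=> x y; rewrite andbC; apply: le_anti.
  - by apply: sort_sorted => x y; apply: le_total.
  - rewrite codomE /= sorted_map.
    have : sorted ltn [seq val i | i <- enum 'I_N].
      by rewrite val_enum_ord iota_ltn_sorted.
    rewrite sorted_map; apply: sub_sorted => i j /= ij.
    by apply: fd; apply: ltnW.
  - by rewrite perm_sort perm_eq_seq_mset.
move=> i; rewrite /degree (tnth_nth \bot) /= E codomE.
by rewrite (nth_map i) ?size_enum_ord // nth_ord_enum.
Qed.

Definition run_meet r s : run REL N := mkrun (fun i => degree r i `&` degree s i).
Definition run_join r s : run REL N := mkrun (fun i => degree r i `|` degree s i).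

Lemma degree_meet r s i : degree (run_meet r s) i = degree r i `&` degree s i.
Proof.
by rewrite degree_mkrun // => {}i j ij; apply: leI2; apply: degree_decr.
Qed.

Lemma degree_join r s i : degree (run_join r s) i = degree r i `|` degree s i.
Proof.
by rewrite degree_mkrun // => {}i j ij; apply: leU2; apply: degree_decr.
Qed.

Fact replacement_refl : reflexive replacement_le.
Proof. by move=> r; apply/replacement_leP. Qed.

Fact replacement_anti : antisymmetric replacement_le.
Proof.
move=> r s /andP[/replacement_leP rs /replacement_leP sr].
by apply: degree_ext => i; apply: le_anti; rewrite rs sr.
Qed.

Fact replacement_trans : transitive replacement_le.
Proof.
move=> s r t /replacement_leP rs /replacement_leP st.
by apply/replacement_leP => i; apply: le_trans (rs i) (st i).
Qed.

HB.instance Definition _ :=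
  Order.Le_isPOrder.Build replacement_display (run REL N)
    replacement_refl replacement_anti replacement_trans.

Lemma run_leE r s : (r <= s) = replacement_le r s. Proof. by []. Qed.

Fact run_meetP r s t : (r <= run_meet s t) = (r <= s) && (r <= t).
Proof.
rewrite !run_leE; apply/replacement_leP/andP
  => [H | [/replacement_leP H1 /replacement_leP H2] i].
  by split; apply/replacement_leP => i;
    move: (H i); rewrite degree_meet lexI => /andP[].
by rewrite degree_meet lexI H1 H2.
Qed.

Fact run_joinP r s t : (run_join r s <= t) = (r <= t) && (s <= t).
Proof.
rewrite !run_leE; apply/replacement_leP/andP
  => [H | [/replacement_leP H1 /replacement_leP H2] i].
  by split; apply/replacement_leP => i;
    move: (H i); rewrite degree_join leUx => /andP[].
by rewrite degree_join leUx H1 H2.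
Qed.

HB.instance Definition _ :=
  Order.POrder_MeetJoin_isLattice.Build replacement_display (run REL N)
    run_meetP run_joinP.

Fact run_meetUl : left_distributive (@run_meet) (@run_join).
Proof.
move=> r s t; apply: degree_ext => i.
by rewrite !(degree_meet, degree_join) meetUl.
Qed.

HB.instance Definition _ :=
  Order.Lattice_Meet_isDistrLattice.Build replacement_display (run REL N)
    run_meetUl.

End Runs.

Local Close Scope order_scope.
Local Open Scope ring_scope.

Definition gain_function (R : realType) d (REL : finTBOrderType d)
    (g : REL -> R) : Prop :=
  [/\ forall a, 0 <= g a,
      g (\bot)%O = 0
    & forall a b, (a < b)%O -> g a < g b].

Definition positive_valuation (R : realType) d (L : latticeType d)
    (M : L -> R) : Prop :=
  (forall x y : L, M x + M y = M (x `|` y)%O + M (x `&` y)%O) /\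
  (forall x y : L, (x <= y)%O -> x <> y -> M x < M y).

Definition gP (R : realType) d (REL : finTBOrderType d) (N : nat)
    (g : REL -> R) (r : run REL N) : R :=
  N%:R^-1 * \sum_(i < N) g (degree r i) / g (\top)%O.

Definition gR (R : realType) d (REL : finTBOrderType d) (N : nat)
    (g : REL -> R) (RB : R) (r : run REL N) : R :=
  RB^-1 * \sum_(i < N) g (degree r i) / g (\top)%O.

(* Main.v *)
(* Both measures are positive multiples of the sum of [g] over the decreasing
   listing. Since the replacement ordering is the componentwise ordering of
   these listings, meet and join take the minimum and the maximum in each
   position: they permute the two degrees found there. *)
Require Import Defs.
From mathcomp Require Import all_boot all_order all_algebra.
From mathcomp Require Import reals.

Import Order.TTheory GRing.Theory Num.Theory.

Local Open Scope ring_scope.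

(** Treats [gP] and [gR] at once: they differ only in the factor [k], and [h] is the gain divided by
    [g \top]. *)
Lemma positive_valuation_scaled_sum (R : realType) (d : Order.disp_t)
    (REL : finTBOrderType d) (N : nat) (k : R) (h : REL -> R) :
  0 < k -> (forall a b, (a < b)%O -> h a < h b) ->
  positive_valuation (L := run REL N)
    (fun r => k * \sum_(i < N) h (degree r i)).
Proof.
move=> k_gt0 h_lt; split=> [r s | r s].
  rewrite -!mulrDr -!big_split /=; congr (_ * _); apply: eq_bigr => i _.
  rewrite degree_join degree_meet.
  by case: (leP (degree r i) (degree s i)) => // _; rewrite addrC.
rewrite run_leE => /replacement_leP le_rs neq_rs; rewrite ltr_pM2l //.
have h_le a b : (a <= b)%O -> h a <= h b.
  by rewrite le_eqVlt => /predU1P[-> // | /h_lt/ltW].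
(* A run is determined by its decreasing listing, so distinct runs differ at some position [i]; the
   increase is strict there and weak elsewhere. *)
have [/forallP eq_rs | ] := boolP [forall i, degree r i == degree s i].
  by case: neq_rs; apply: degree_ext => i; apply/eqP.
rewrite negb_forall => /existsP[i neq_i].
rewrite (bigD1 i) //= [ltRHS](bigD1 i) //=; apply: ltr_leD.
  by apply: h_lt; rewrite lt_neqAle neq_i le_rs.
by apply: ler_sum => j _; apply: h_le.
Qed.

Theorem proposition2 (R : realType) (d : Order.disp_t) (REL : finTBOrderType d)
    (N c : nat) (hN : (1 <= N)%N) (hc : (1 <= c)%N) (hREL : #|REL| = c.+1)
    (g : REL -> R) (hg : gain_function g) (RB : R) (hRB : 0 < RB) :
  positive_valuation (L := run REL N) (fun r => gP g r) /\
  positive_valuation (L := run REL N) (fun r => gR g RB r).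
Proof.
have [_ g0 g_lt] := hg.
(* Since [c >= 1] there are two distinct degrees. This makes [g \top] positive, so dividing by it
   keeps strict inequalities. *)
have bot_lt_top : (\bot < \top :> REL)%O.
  rewrite lt_neqAle le0x andbT; apply/eqP => bot_top.
  suff : (#|REL| <= 1)%N by rewrite hREL ltnS leqNgt hc.
  apply/fintype_le1P => a b.
  have eq_bot (x : REL) : x = \bot%O.
    by apply/eqP; rewrite -lex0 bot_top lex1.
  by rewrite (eq_bot a) (eq_bot b).
have g_top_gt0 : 0 < g \top%O by rewrite -g0 g_lt.
have h_lt (a b : REL) : (a < b)%O -> g a / g \top%O < g b / g \top%O.
  by move=> ab; rewrite ltr_pM2r ?invr_gt0 // g_lt.
(* Unification finds [k] as [N%:R^-1], then [RB^-1], positive by [hN] and [hRB]. *)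
split; apply: (@positive_valuation_scaled_sum _ _ _ _ _
  (fun a => g a / g \top%O)) => //; by rewrite invr_gt0 ?ltr0n.
Qed.
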